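(* Let $\mathfrak{A}$ be a unital $C^*$-algebra, $a\in\mathfrak{A}$ a nonzero positive element, and let $x,y\in\mathfrak{A}_a$. Then $$v_a(xy)\le\|xy\|_a\le\min\{K_1,K_2,K_3\}\le 4v_a(x)v_a(y),$$ where $K_1=\|x\|_a\big(v_a(y)+d_a(y)\big)$, $K_2=\|y\|_a\big(v_a(x)+d_a(x)\big)$ and $K_3=\big(v_a(x)+d_a(x)\big)\big(v_a(y)+d_a(y)\big)$.
   Context: $\mathcal{S}(\mathfrak{A})$ is the set of states of $\mathfrak{A}$ and $\mathcal{S}_a(\mathfrak{A})=\{f/f(a): f\in\mathcal{S}(\mathfrak{A}),\ f(a)\ne 0\}$. For $x\in\mathfrak{A}$, $\|x\|_a=\sup\{\sqrt{f(x^*ax)}: f\in\mathcal{S}_a(\mathfrak{A})\}\in[0,\infty]$, and the $a$-numerical radius is $v_a(x)=\sup\{|f(ax)|: f\in\mathcal{S}_a(\mathfrak{A})\}$. An element $x^{\sharp_a}\in\mathfrak{A}$ is an $a$-adjoint of $x$ if $ax^{\sharp_a}=x^*a$; $\mathfrak{A}_a$ is the set of all elements of $\mathfrak{A}$ admitting an $a$-adjoint (a subalgebra of $\mathfrak{A}$ on which $\|\cdot\|_a$ is a finite semi-norm). For $x\in\mathfrak{A}_a$, $d_a(x)=\inf_{\zeta\in\mathbb{C}}v_a(x-\zeta\mathbf{1})$, where $\mathbf{1}$ is the unit of $\mathfrak{A}$. *)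

(* Defs.v *)
From HB Require Import structures.
From mathcomp Require Import all_boot all_order all_algebra.
From mathcomp Require Import complex.
From mathcomp Require Import all_classical all_reals ereal.

Set Implicit Arguments.
Unset Strict Implicit.
Unset Printing Implicit Defensive.

Import Order.TTheory GRing.Theory Num.Theory.

Local Open Scope complex_scope.
Local Open Scope classical_set_scope.
Local Open Scope ring_scope.

(* The norm of [R[i]] takes its values in [R[i]]; [cmod z] is the same modulus
   as an element of [R]. *)
Definition cmod (R : realType) (z : R[i]) : R := complex.Re `|z|.

(* The norm is a field of the structure, rather than an inherited
   [normedModType R[i]], because Hierarchy-Builder has no join of rings and
   normed modules below [numDomainType]. A unital algebra is an [algType], so
   [1 != 0] and the zero algebra is excluded. *)
HB.mixin Record isUnitalCStarAlgebra (R : realType) A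
    of GRing.Algebra R[i] A := {
  star : A -> A ;
  starK : involutive star ;
  starD : {morph star : x y / x + y} ;
  starZ : forall (c : R[i]) (x : A), star (c *: x) = conjc c *: star x ;
  starM : forall x y : A, star (x * y) = star y * star x ;
  cnorm : A -> R ;
  cnormD : forall x y : A, cnorm (x + y) <= cnorm x + cnorm y ;
  cnormZ : forall (c : R[i]) (x : A), cnorm (c *: x) = cmod c * cnorm x ;
  cnorm0_eq0 : forall x : A, cnorm x = 0 -> x = 0 ;
  cnormM : forall x y : A, cnorm (x * y) <= cnorm x * cnorm y ;
  cnorm_star : forall x : A, cnorm (star x * x) = cnorm x ^+ 2 ;
  cnorm_complete : forall u : nat -> A,
    (forall e : R, 0 < e -> exists N : nat, forall m n : nat,
       (N <= m)%N -> (N <= n)%N -> cnorm (u m - u n) < e) ->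
    exists l : A, forall e : R, 0 < e -> exists N : nat, forall n : nat,
       (N <= n)%N -> cnorm (u n - l) < e
}.

#[short(type="unitalCStarAlgType")]
HB.structure Definition UnitalCStarAlgebra (R : realType) :=
  {A of GRing.Algebra R[i] A & isUnitalCStarAlgebra R A}.

Section ANumericalRadius.
Context (R : realType) (A : unitalCStarAlgType R).
Implicit Types (a x : A).

Definition cstar_positive a : Prop := exists b : A, a = star b * b.

Definition functional_norm (f : A -> R[i]) : \bar R :=
  ereal_sup [set (cmod (f x))%:E | x in [set x : A | cnorm x <= 1]].

(* In [R[i]], [0 <= z] means that [z] is real and nonnegative. *)
Definition state (f : {scalar A}) : Prop :=
  (forall x, cstar_positive x -> 0 <= f x) /\ functional_norm f = 1%E.

Definition states_at a : set (A -> R[i]) :=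
  [set (fun x => f x / f a) | f in [set f : {scalar A} | state f /\ f a != 0]].

(* For positive [a] and [f] in [states_at a], [f (star x * a * x)] is real and
   nonnegative, so taking its real part loses nothing. *)
Definition anorm a x : \bar R :=
  ereal_sup [set (Num.sqrt (complex.Re (f (star x * a * x))))%:E
            | f in states_at a].

Definition aradius a x : \bar R :=
  ereal_sup [set (cmod (f (a * x)))%:E | f in states_at a].

Definition adjointable a : set A :=
  [set x | exists xs : A, a * xs = star x * a].

Definition adist a x : \bar R :=
  ereal_inf [set aradius a (x - zeta *: 1) | zeta in [set: R[i]]].

End ANumericalRadius.

(* Main.v *)
(* For a state [f] with [f a != 0] and any [u], the functional
   [f (u^* . u) / f (u^* a u)] is again in [states_at a] as soon as its
   denominator is nonzero. Hence the bounds defining the seminorm and the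
   radius, a priori only bounds at the vector [1] of the semi-inner product
   [<u, v> = f (u^* a v)], hold at every vector [u], and the [a]-numerical
   radius behaves like the numerical radius of left multiplication. This gives
   submultiplicativity of the seminorm, and polarization gives
   [anorm a y <= aradius a y + aradius a (y - zeta)] for every [zeta].
   If no state satisfied [f a != 0], every supremum would be [-oo] and the
   inequalities would hold trivially in the extended reals. *)

Require Import Defs.
From HB Require Import structures.
From mathcomp Require Import all_boot all_order all_algebra complex.
From mathcomp Require Import ring lra.
From mathcomp Require Import all_classical all_reals ereal.

Set Implicit Arguments.
Unset Strict Implicit.
Unset Printing Implicit Defensive.

Import Order.TTheory GRing.Theory Num.Theory.

Local Open Scope ring_scope.

(** * The real-valued modulus on [R[i]] *)

Section Modulus.
Context (R : realType).
Implicit Types (z w : R[i]).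

Lemma cmodE z : `|z| = (cmod z)%:C%C.
Proof. by rewrite /cmod normc_def. Qed.

Lemma cmod_ge0 z : 0 <= cmod z.
Proof. by rewrite -ler0c -cmodE. Qed.

Lemma cmodM z w : cmod (z * w) = cmod z * cmod w.
Proof. by apply: complexI; rewrite rmorphM /= -!cmodE normrM. Qed.

Lemma cmodD z w : cmod (z + w) <= cmod z + cmod w.
Proof. by rewrite -lecR rmorphD /= -!cmodE ler_normD. Qed.

Lemma cmodN z : cmod (- z) = cmod z.
Proof. by rewrite /cmod normrN. Qed.

Lemma cmodJ z : cmod z^*%C = cmod z.
Proof. by rewrite /cmod normcJ. Qed.

Lemma cmod_real (r : R) : 0 <= r -> cmod r%:C%C = r.
Proof. by move=> r0; rewrite /cmod ger0_norm ?ler0c. Qed.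

Lemma cmod_eq0 z : (cmod z == 0) = (z == 0).
Proof. by rewrite -[RHS]normr_eq0 cmodE eq_complex /= eqxx andbT. Qed.

Lemma cmod0 : cmod (0 : R[i]) = 0.
Proof. by apply/eqP; rewrite cmod_eq0. Qed.

Lemma cmod1 : cmod (1 : R[i]) = 1.
Proof. by rewrite /cmod normr1. Qed.

Lemma cmodV z : cmod z^-1 = (cmod z)^-1.
Proof. by apply: complexI; rewrite fmorphV /= -!cmodE normfV. Qed.

Lemma cmod_sqr z : cmod z ^+ 2 = complex.Re z ^+ 2 + complex.Im z ^+ 2.
Proof. by apply: complexI; rewrite add_Re2_Im2 rmorphXn /= -cmodE. Qed.

Lemma ReD z w : complex.Re (z + w) = complex.Re z + complex.Re w.
Proof. by case: z w => [? ?] []. Qed.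

Lemma ge0_ReK z : 0 <= z -> (complex.Re z)%:C%C = z.
Proof. by case: z => p q /ger0_Im /= ->. Qed.

Lemma Re_ge0 z : 0 <= z -> 0 <= complex.Re z.
Proof. by rewrite lecE => /andP[]. Qed.

Lemma Re_cmod z : 0 <= z -> cmod z = complex.Re z.
Proof. by move=> z0; rewrite /cmod ger0_norm. Qed.

Lemma real_phase z : exists t, cmod t = 1 /\ complex.Im (t * z) = 0.
Proof.
have [->|z0] := eqVneq z 0.
  by exists 1; rewrite mulr0 cmod1.
exists (z^*%C / `|z|); split.
  by rewrite cmodM cmodV cmodJ cmodE cmod_real ?cmod_ge0 // divff ?cmod_eq0.
by rewrite mulrAC [_ * z]mulrC -sqr_normc expr2 mulfK ?normr_eq0 // cmodE.
Qed.

End Modulus.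

(** * Positive semidefinite sesquilinear forms: Cauchy-Schwarz and polarization *)

Section PositiveForms.
Context (R : realType) (V : lmodType R[i]).
Implicit Types (B T : V -> V -> R[i]) (u v w : V) (c : R[i]).

Definition sesqform B :=
  [/\ (forall u v w, B (u + v) w = B u w + B v w),
      (forall u v w, B w (u + v) = B w u + B w v),
      (forall c u v, B (c *: u) v = c^*%C * B u v)
    & (forall c u v, B u (c *: v) = c * B u v)].

Definition psdform B := sesqform B /\ forall u, 0 <= B u u.

Lemma psdform_herm B u v : psdform B -> B v u = (B u v)^*%C.
Proof.
move=> [[Dl Dr Zl Zr] B0].
have := B0 (u + 1 *: v); have := B0 (u + 'i%C *: v).
have := B0 u; have := B0 v.
rewrite !(Dl, Dr, Zl, Zr) => /ger0_Im + /ger0_Im + /ger0_Im + /ger0_Im.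
case: (B u u) (B v v) (B u v) (B v u) => [a1 a2] [b1 b2] [p1 p2] [q1 q2] /=.
by move=> *; congr Complex; lra.
Qed.

Lemma psdform_CauchySchwarz B u v : psdform B ->
  cmod (B u v) ^+ 2 <= complex.Re (B u u) * complex.Re (B v v).
Proof.
move=> BP; have [[Dl Dr Zl Zr] B0] := BP.
have quad (c : R[i]) := Re_ge0 (B0 (u + c *: v)).
have [Hu Hv] := (Re_ge0 (B0 u), Re_ge0 (B0 v)).
have [Iu Iv] := (ger0_Im (B0 u), ger0_Im (B0 v)).
have hq := psdform_herm u v BP.
have {}quad (c1 c2 : R) : 0 <= complex.Re (B u u) +
  (c1 ^+ 2 + c2 ^+ 2) * complex.Re (B v v) +
  2 * (c1 * complex.Re (B u v) - c2 * complex.Im (B u v)).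
  have := quad (c1 +i* c2)%C; rewrite !(Dl, Dr, Zl, Zr) hq.
  move: Iu Iv; case: (B u u) (B v v) (B u v) => [a1 a2] [b1 b2] [p1 p2] /=.
  by move=> _ ->; lra.
rewrite cmod_sqr; move: Hu Hv quad.
move: (complex.Re (B u u)) (complex.Re (B v v)) => U W.
move: (complex.Re (B u v)) (complex.Im (B u v)) => p q U0 W0 quad.
have [W0'|Wn] := eqVneq W 0; last first.
  have Wp : 0 < W by rewrite lt_def Wn.
  (* The minimizer of the quadratic, minus the conjugate of [B u v] divided by [W]. *)
  have := quad (- p / W) (q / W).
  rewrite -(pmulr_rge0 _ Wp).
  have -> : W * (U + ((- p / W) ^+ 2 + (q / W) ^+ 2) * W +
   2 * (- p / W * p - q / W * q)) = U * W - (p ^+ 2 + q ^+ 2) by field.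
  by rewrite subr_ge0.
rewrite {}W0' in quad *.
rewrite mulr0 leNgt; apply/negP => n0.
(* With [W = 0] the quadratic is affine in [c]; this choice gives it the negative value
   [- U - 2]. *)
have := quad (- (U + 1) / (p ^+ 2 + q ^+ 2) * p)
  ((U + 1) / (p ^+ 2 + q ^+ 2) * q).
have -> : U + ((- (U + 1) / (p ^+ 2 + q ^+ 2) * p) ^+ 2 +
  ((U + 1) / (p ^+ 2 + q ^+ 2) * q) ^+ 2) * 0 +
  2 * (- (U + 1) / (p ^+ 2 + q ^+ 2) * p * p -
       (U + 1) / (p ^+ 2 + q ^+ 2) * q * q)
 = - U - 2 by field; lra.
by lra.
Qed.

(* Polarization splits [4 * T e u] into a symmetric part, seen by [T], and an
   antisymmetric part, which does not change when [zeta * B] is subtracted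
   from [T] because [B u e] is real. *)
Lemma offdiagonal_le B T zeta (v w : R) u e :
  psdform B -> sesqform T ->
  (forall x, cmod (T x x) <= v * complex.Re (B x x)) ->
  (forall x, cmod (T x x - zeta * B x x) <= w * complex.Re (B x x)) ->
  B u u = 1 -> B e e = 1 -> complex.Im (B u e) = 0 ->
  cmod (T e u) <= v + w.
Proof.
move=> BP [TDl TDr TZl TZr] Tv Tw uu ee ue0.
have [[Dl Dr Zl Zr] B0] := BP.
have ue : B u e = B e u.
  rewrite (psdform_herm u e BP); move: ue0.
  by case: (B u e) => p q /= ->; rewrite oppr0.
(* Parallelogram law for the unit vectors [u] and [c *: e]; the total 4 cancels the factor 4 of
   polarization. *)
have sumB c : c^*%C * c = 1 ->
    complex.Re (B (u + c *: e) (u + c *: e)) +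
    complex.Re (B (u - c *: e) (u - c *: e)) = 4.
  move=> cc; rewrite -ReD -(scaleN1r (_ *: e)) !scalerA.
  rewrite !(Dl, Dr, Zl, Zr) uu ee -ue rmorphM rmorphN rmorph1.
  have -> : 1 + c * B u e + (c^*%C * B u e + c^*%C * (c * 1)) +
    (1 + -1 * c * B u e + (-1 * c^*%C * B u e + -1 * c^*%C * (-1 * c * 1))) =
    2 + 2 * (c^*%C * c) by ring.
  by rewrite cc mulr1 -natrD -(rmorph_nat (real_complex R)).
have key c X (S : V -> R[i]) r : c^*%C * c = 1 ->
    (forall x, cmod (S x) <= r * complex.Re (B x x)) ->
    S (u + c *: e) - S (u - c *: e) = X -> cmod X <= 4 * r.
  move=> cc Sr <-; apply: le_trans (cmodD _ _) _; rewrite cmodN.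
  apply: le_trans (lerD (Sr _) (Sr _)) _.
  by rewrite -mulrDr sumB // mulrC.
have h1 := key 1 (2 * (T u e + T e u)) (fun x => T x x) v.
have h2 := key 'i%C (2 * 'i%C * (T u e - T e u))
   (fun x => T x x - zeta * B x x) w.
have {}h1 : cmod (2 * (T u e + T e u)) <= 4 * v.
  apply: h1 => //; first by rewrite conjc1 mul1r.
  rewrite -(scaleN1r (_ *: e)) !scalerA !(TDl, TDr, TZl, TZr).
  rewrite mulr1 rmorphN rmorph1.
  by ring.
have i2 : ('i%C : R[i]) ^+ 2 = -1 by exact: sqr_i.
have ci : ('i%C : R[i])^*%C = - 'i%C.
  by apply/eqP; rewrite eq_complex /= oppr0 !eqxx.
have cni : (-1 * 'i%C : R[i])^*%C = 'i%C.
  by rewrite mulN1r; apply/eqP; rewrite eq_complex /= oppr0 opprK !eqxx.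
have {}h2 : cmod (2 * 'i%C * (T u e - T e u)) <= 4 * w.
  apply: h2 => //; first by rewrite ci mulNr -expr2 i2 opprK.
  rewrite -(scaleN1r (_ *: e)) !scalerA !(TDl, TDr, TZl, TZr, Dl, Dr, Zl, Zr).
  rewrite ue ci cni.
  by ring.
have two : cmod (2 : R[i]) = 2.
  by rewrite -[2 in LHS](rmorph_nat (real_complex R)) cmod_real.
have ni : cmod ('i%C : R[i]) = 1.
  apply/eqP; rewrite -(@eqrXn2 _ 2) ?cmod_ge0 // cmod_sqr /=.
  by rewrite expr0n expr1n add0r.
rewrite !cmodM two in h1; rewrite !cmodM two ni in h2.
have : cmod (2 * T e u) <= cmod (T u e + T e u) + cmod (T u e - T e u).
  rewrite -[X in _ <= _ + X]cmodN; apply: le_trans _ (cmodD _ _).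
  by rewrite le_eqVlt; apply/orP; left; apply/eqP; congr cmod; ring.
by rewrite cmodM two; lra.
Qed.

End PositiveForms.

(** * Positive functionals and their norms *)

Section PositiveFunctionals.
Context (R : realType) (A : unitalCStarAlgType R).
Implicit Types (x y u v a : A) (f g : {scalar A}).

Lemma star1 : star (1 : A) = 1.
Proof. by rewrite -[LHS]mulr1 -{2}(starK (1 : A)) -starM mulr1 starK. Qed.

Lemma cnorm0 : cnorm (0 : A) = 0.
Proof. by rewrite -(scale0r (0 : A)) cnormZ cmod0 mul0r. Qed.

Lemma cnormN x : cnorm (- x) = cnorm x.
Proof. by rewrite -scaleN1r cnormZ cmodN cmod1 mul1r. Qed.

Lemma cnorm_ge0 x : 0 <= cnorm x.
Proof. by have := cnormD x (- x); rewrite subrr cnorm0 cnormN; lra. Qed.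

(** The C*-identity and submultiplicativity give [cnorm y ^+ 2 <= cnorm (star y) * cnorm y]. *)
Lemma cnorm_starE x : cnorm (star x) = cnorm x.
Proof.
suff le y : cnorm y <= cnorm (star y).
  by apply/eqP; rewrite eq_le le andbT -{2}(starK x) le.
have [y0|yn] := eqVneq (cnorm y) 0; first by rewrite y0 cnorm_ge0.
have yp : 0 < cnorm y by rewrite lt_def yn cnorm_ge0.
by rewrite -(ler_pM2r yp) -expr2 -cnorm_star cnormM.
Qed.

Lemma cnorm1_le1 : cnorm (1 : A) <= 1.
Proof.
have := cnorm_star (1 : A); rewrite star1 mulr1 expr2 => e.
have [->//|n] := eqVneq (cnorm (1 : A)) 0.
by rewrite -(mulfK n (cnorm 1)) -e divff.
Qed.

Definition positive_functional f := forall x, cstar_positive x -> 0 <= f x.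

Lemma form_psd f a : positive_functional f -> cstar_positive a ->
  psdform (fun u v => f (star u * a * v)).
Proof.
move=> fP [b ->]; split; last first.
  by move=> u; apply: fP; exists (b * u); rewrite starM !mulrA.
split=> *; rewrite ?starD ?starZ ?(mulrDl, mulrDr) -?(scalerAl, scalerAr);
  by rewrite ?linearD ?linearZ.
Qed.

Lemma cstar_positive1 : cstar_positive (1 : A).
Proof. by exists 1; rewrite star1 mulr1. Qed.

Lemma functional_CauchySchwarz f u v : positive_functional f ->
  cmod (f (star u * v)) ^+ 2 <=
  complex.Re (f (star u * u)) * complex.Re (f (star v * v)).
Proof.
move=> fP; have := psdform_CauchySchwarz u v (form_psd fP cstar_positive1).
by rewrite !mulr1.
Qed.

Lemma square_ge0 f x : positive_functional f -> 0 <= f (star x * x).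
Proof. by apply; exists x. Qed.

Lemma functional1_ge0 f : positive_functional f -> 0 <= complex.Re (f 1).
Proof. by move=> fP; apply/Re_ge0/fP/cstar_positive1. Qed.

(* Cauchy-Schwarz against [1] turns any bound [C] for [f (x^* x)] on the unit
   ball into the bound [sqrt (f 1 * C)], so the least one is at most [f 1]. *)
Lemma positive_square_le f (M : R) x : positive_functional f ->
  (forall x, cmod (f x) <= M * cnorm x) ->
  cnorm x <= 1 -> complex.Re (f (star x * x)) <= complex.Re (f 1).
Proof.
move=> fP fM.
pose E : set R :=
  [set complex.Re (f (star z * z)) | z in [set z : A | cnorm z <= 1]]%classic.
have sq1 (z : A) : cnorm z <= 1 -> cnorm (star z * z) <= 1.
  by move=> z1; rewrite cnorm_star; apply: exprn_ile1 => //; exact: cnorm_ge0.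
(* The a priori bound [M] makes the supremum finite, so that it can be divided out at the end. *)
have Eub : has_ubound E.
  exists `|M| => _ [z /= /sq1 z1 <-].
  rewrite -Re_cmod ?square_ge0 //; apply: le_trans (fM _) _.
  apply: le_trans (ler_wpM2r (cnorm_ge0 _) (ler_norm M)) _.
  by rewrite ler_piMr.
have E0 : E 0 by exists 0; rewrite /= ?cnorm0 // mulr0 linear0.
have C0 : 0 <= sup E := ub_le_sup Eub E0.
have P0 := functional1_ge0 fP.
have step : sup E <= Num.sqrt (complex.Re (f 1) * sup E).
  apply: ge_sup; first by exists 0.
  move=> _ [z /= z1 <-].
  apply: le_trans (ler_norm _) _; rewrite -sqrtr_sqr ler_wsqrtr //.
  have := functional_CauchySchwarz 1 (star z * z) fP.
  rewrite star1 !mul1r Re_cmod ?square_ge0 // => /le_trans; apply.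
  apply: ler_wpM2l => //; apply: ub_le_sup => //.
  by exists (star z * z) => //; exact: sq1.
move=> x1; have xE : complex.Re (f (star x * x)) <= sup E.
  by apply: ub_le_sup => //; exists x.
apply: le_trans xE _.
have [->//|Cn] := eqVneq (sup E) 0.
have Cp : 0 < sup E by rewrite lt_def Cn.
rewrite -(ler_pM2r Cp) -expr2 -[X in _ <= X]sqr_sqrtr ?mulr_ge0 //.
by rewrite ler_pXn2r ?nnegrE ?sqrtr_ge0.
Qed.

(** A bounded positive functional attains its norm at [1]: Cauchy-Schwarz against [1] gives
    [|f x|^2 <= f 1 * f (x^* x)], which is at most [(f 1)^2]. *)
Lemma positive_functional_le f (M : R) x : positive_functional f ->
  (forall x, cmod (f x) <= M * cnorm x) ->
  cnorm x <= 1 -> cmod (f x) <= complex.Re (f 1).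
Proof.
move=> fP fM x1; have P0 := functional1_ge0 fP.
rewrite -(ler_pXn2r (n := 2)) ?nnegrE ?cmod_ge0 //.
have := functional_CauchySchwarz 1 x fP.
rewrite star1 !mul1r => /le_trans; apply; rewrite expr2.
exact: ler_wpM2l (positive_square_le fP fM x1).
Qed.

Lemma state_le f x : state f -> cmod (f x) <= cnorm x.
Proof.
move=> [_ fn].
have [x0|xn] := eqVneq (cnorm x) 0.
  by rewrite (cnorm0_eq0 _ x0) linear0 cnorm0 cmod0.
have xp : 0 < cnorm x by rewrite lt_def xn cnorm_ge0.
have ni : cmod ((cnorm x)^-1)%:C%C = (cnorm x)^-1.
  by rewrite cmod_real // invr_ge0 ltW.
have : ((cmod (f (((cnorm x)^-1)%:C%C *: x)))%:E <= functional_norm f)%E.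
  by apply: ereal_sup_ubound; eexists; last by []; rewrite /= cnormZ ni mulVf.
rewrite fn lee_fin linearZ /= cmodM ni.
by rewrite -ler_pdivlMl ?invr_gt0 // invrK mulr1.
Qed.

End PositiveFunctionals.

(** * Compression of states, and the seminorm and radius inequalities *)

Section StatesAt.
Context (R : realType) (A : unitalCStarAlgType R).
Implicit Types (x y z u a : A) (f g G : {scalar A}) (F : A -> R[i]).

Lemma scalar_fun (h : A -> R[i]) : scalar h -> exists g, h = g :> (A -> R[i]).
Proof.
move=> hlin.
pose H := GRing.isLinear.Build R[i] A R[i]^o *%R h hlin.
pose g : {scalar A} := HB.pack h H.
by exists g.
Qed.

(** By Cauchy-Schwarz a null vector is orthogonal to every vector. This settles the cases with a
    zero denominator. *)
Lemma form_eq0 f a u v : positive_functional f -> cstar_positive a ->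
  f (star u * a * u) = 0 -> f (star u * a * v) = 0.
Proof.
move=> fP aP f0; have := psdform_CauchySchwarz u v (form_psd fP aP).
rewrite f0 mul0r => le0; apply/eqP.
rewrite -cmod_eq0 -sqrf_eq0.
by rewrite eq_le le0 exprn_ge0 ?cmod_ge0.
Qed.

(** The compressed functional is positive, bounded and equal to 1 at [1], so its norm is its value
    at [1]. *)
Lemma compression_state f u : state f -> f (star u * u) != 0 ->
  exists2 g, state g &
    forall x, g x = f (star u * x * u) / f (star u * u).
Proof.
move=> fS fu; have [fP _] := fS.
set q := f (star u * u) in fu *.
have q0 : 0 <= q by apply: square_ge0.
have /scalar_fun[g gE] : scalar (fun x => f (star u * x * u) / q).
  move=> c x y.
  by rewrite mulrDr mulrDl -scalerAr -scalerAl linearP /= mulrDl mulrA.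
have {}gE x : g x = f (star u * x * u) / q by rewrite -gE.
have gP : positive_functional g.
  move=> _ [b ->]; rewrite gE divr_ge0 // mulrA -starM -mulrA.
  exact: square_ge0.
have g1 : g 1 = 1 by rewrite gE mulr1 divff.
have gM x : cmod (g x) <= (cnorm u * cnorm u / cmod q) * cnorm x.
  rewrite gE cmodM cmodV mulrAC ler_wpM2r ?invr_ge0 ?cmod_ge0 //.
  apply: le_trans (state_le _ fS) _; apply: le_trans (cnormM _ _) _.
  rewrite -[leRHS]mulrA [leRHS]mulrC ler_wpM2r ?cnorm_ge0 //.
  by apply: le_trans (cnormM _ _) _; rewrite cnorm_starE.
exists g => //; split=> //; apply/eqP; rewrite eq_le; apply/andP; split.
  apply: ge_ereal_sup => _ [x /= x1 <-]; rewrite lee_fin.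
  by apply: le_trans (positive_functional_le gP gM x1) _; rewrite g1.
apply: ereal_sup_ubound; exists 1; first exact: cnorm1_le1.
by rewrite g1 cmod1.
Qed.

Lemma states_atP a F : cstar_positive a -> states_at a F ->
  exists G, [/\ F = G, positive_functional G, G a = 1 &
    forall u, G (star u * a * u) != 0 ->
      states_at a (fun x => G (star u * x * u) / G (star u * a * u))].
Proof.
move=> aP [f [fS fa] <-]; have [fP _] := fS.
have /scalar_fun[G GE] : scalar (fun x => f x / f a).
  by move=> c x y; rewrite linearP /= mulrDl mulrA.
have GE' x : G x = f x / f a by rewrite -GE.
exists G; split=> //.
- by move=> x xP; rewrite GE' divr_ge0 // fP.
- by rewrite GE' divff.
move=> u; rewrite GE' mulf_eq0 invr_eq0 negb_or fa andbT => fuau.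
(* If [f (u^* u)] vanished, [u] would be null for the form of [1], hence orthogonal to [a u]. *)
have fu : f (star u * u) != 0.
  apply: contra_neq fuau => f0; rewrite -mulrA -[star u]mulr1.
  by apply: form_eq0 => //; [exact: cstar_positive1 | rewrite mulr1].
have [g gS gE] := compression_state fS fu.
exists g; first by split=> //=; rewrite gE mulf_neq0 ?invr_eq0.
by apply/funext => x; rewrite !gE !GE'; field; rewrite fa fu fuau.
Qed.

(** The radius bound is applied to the compression of [F] by [u]; if [u] is null, both sides
    vanish. *)
Lemma states_at_radius_le a F z u (v : R) : cstar_positive a ->
  states_at a F -> (aradius a z <= v%:E)%E ->
  cmod (F (star u * a * (z * u))) <= v * complex.Re (F (star u * a * u)).
Proof.
move=> aP /(states_atP aP)[G [-> GP _ Gu]] zv.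
have G0 : 0 <= G (star u * a * u) := (form_psd GP aP).2 u.
have [g0|gn] := eqVneq (G (star u * a * u)) 0.
  by rewrite (form_eq0 _ GP aP g0) g0 mulr0 cmod0.
rewrite -Re_cmod // -ler_pdivrMr ?lt_def ?cmod_eq0 ?gn ?cmod_ge0 //.
rewrite -lee_fin; apply: le_trans _ zv; apply: ereal_sup_ubound.
by eexists; first exact: Gu gn; rewrite cmodM cmodV !mulrA.
Qed.

Lemma aradius_ge0 a z F : states_at a F -> (0 <= aradius a z)%E.
Proof.
move=> FS; apply: le_trans _ (ereal_sup_ubound _); last by exists F.
by rewrite lee_fin cmod_ge0.
Qed.

Lemma anorm_ge0 a z F : states_at a F -> (0 <= anorm a z)%E.
Proof.
move=> FS; apply: le_trans _ (ereal_sup_ubound _); last by exists F.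
by rewrite lee_fin sqrtr_ge0.
Qed.

Lemma adist_ge0 a z F : states_at a F -> (0 <= adist a z)%E.
Proof.
by move=> FS; apply: le_ereal_inf_tmp => _ [c _ <-]; exact: aradius_ge0 FS.
Qed.

Lemma adist_le a z : (adist a z <= aradius a z)%E.
Proof.
by apply: ereal_inf_lbound; exists 0 => //; rewrite scale0r subr0.
Qed.

(** Cauchy-Schwarz between [1] and [z], where [1] has length 1 because [G a = 1]. *)
Lemma aradius_le_anorm a z : cstar_positive a ->
  (aradius a z <= anorm a z)%E.
Proof.
move=> aP; apply: ge_ereal_sup => _ [F FS <-].
apply: le_trans _ (ereal_sup_ubound _); last by exists F.
rewrite lee_fin; have [G [-> GP Ga _]] := states_atP aP FS.
have := psdform_CauchySchwarz 1 z (form_psd GP aP).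
rewrite star1 !mul1r mulr1 Ga mul1r => h.
by rewrite -(ger0_norm (cmod_ge0 _)) -sqrtr_sqr ler_wsqrtr.
Qed.

Lemma anormM_le a x y : cstar_positive a -> adjointable a x ->
  (anorm a (x * y)%R <= anorm a x * anorm a y)%E.
Proof.
move=> aP [xs xsE]; apply: ge_ereal_sup => _ [F FS <-].
have [G [FG GP _ Gu]] := states_atP aP FS; rewrite FG.
have G0 : 0 <= G (star y * a * y) := (form_psd GP aP).2 y.
rewrite starM -!mulrA.
have [g0|gn] := eqVneq (G (star y * a * y)) 0.
  (* The [a]-adjoint of [x] moves [a] next to [star y], exposing a product with the null vector
     [y]. *)
  have -> : star y * (star x * (a * (x * y))) = star y * a * (xs * (x * y)).
    by rewrite -mulrA [in RHS](mulrA a) xsE -!mulrA.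
  rewrite (form_eq0 _ GP aP g0) sqrtr0.
  by rewrite mule_ge0 // (anorm_ge0 _ FS).
set q := G (star y * a * y) in G0 gn *.
(* [r] is the value at [x^* a x] of the compression by [y], so [Re r] is bounded by the square of
   [anorm a x]. *)
pose r := G (star y * (star x * a * x) * y) / q.
have -> : G (star y * (star x * (a * (x * y)))) = r * (complex.Re q)%:C%C.
  by rewrite ge0_ReK // /r divfK // !mulrA.
have -> : complex.Re (r * (complex.Re q)%:C%C) = complex.Re r * complex.Re q.
  by case: r => r1 r2 /=; rewrite mulr0 subr0.
rewrite mulrC sqrtrM ?Re_ge0 // EFinM muleC.
apply: lee_pmul; rewrite ?lee_fin ?sqrtr_ge0 //.
  by apply: ereal_sup_ubound; eexists; first exact: Gu gn.
by apply: ereal_sup_ubound; exists F; rewrite // FG.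
Qed.

(* [offdiagonal_le] is applied to [1] and [e = t y / |y|], where the phase [t]
   makes the inner product of [1] and [e] real. *)
Lemma anorm_le_aradiusD a y : cstar_positive a ->
  (anorm a y <= aradius a y + adist a y)%E.
Proof.
move=> aP; apply: ge_ereal_sup => _ [F FS <-].
have v0 := aradius_ge0 y FS; have d0 := adist_ge0 y FS.
move vE : (aradius a y) v0 => v.
case: v vE => [v||] vE v0 //; last first.
  (* An infinite radius makes the right side [+oo], since [adist] is not [-oo]. *)
  by rewrite addye ?leey // -ltNye (lt_le_trans _ d0).
(* Subtracting the finite [v] isolates the infimum, leaving one bound for each [zeta]. *)
rewrite -leeBlDl //; apply: le_ereal_inf_tmp => _ [zeta _ <-].
move wE : (aradius a (y - zeta *: 1)) (aradius_ge0 (y - zeta *: 1) FS) => w.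
case: w wE => [w||] wE w0 //; last by rewrite leey.
rewrite leeBlDl // -EFinD lee_fin.
have Fv u : cmod (F (star u * a * (y * u)))
    <= v * complex.Re (F (star u * a * u)).
  by apply: states_at_radius_le => //; rewrite vE.
have Fw u : cmod (F (star u * a * ((y - zeta *: 1) * u)))
    <= w * complex.Re (F (star u * a * u)).
  by apply: states_at_radius_le => //; rewrite wE.
have [G [FG GP Ga _]] := states_atP aP FS; rewrite {F FS}FG in Fv Fw *.
have BP := form_psd GP aP; set B := (fun u v : A => _) in BP.
have [[Dl Dr Zl Zr] B0] := BP.
have Byy : 0 <= B y y := B0 y.
have [t [t1 tr]] := real_phase (B 1 y).
pose N := Num.sqrt (complex.Re (B y y)).
rewrite -[Num.sqrt _]/N.
have [->|Nn] := eqVneq N 0; first by rewrite addr_ge0 // -lee_fin.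
have Np : 0 < N by rewrite lt_def Nn sqrtr_ge0.
have NN : B y y = (N ^+ 2)%:C%C by rewrite sqr_sqrtr ?Re_ge0 // ge0_ReK.
have Nc : (N%:C%C : R[i]) != 0 by rewrite eq_complex /= negb_and Nn.
have tt : t^*%C * t = 1 by rewrite mulrC -sqr_normc cmodE t1 expr1n.
pose e := (t / N%:C%C) *: y.
have ec : (t / N%:C%C)^*%C = t^*%C / N%:C%C.
  by rewrite [LHS]rmorphM; congr (_ * _); rewrite [LHS]conjc_inv conjc_real.
(* [N] is the modulus of the entry of left multiplication by [y] between [e] and [1]. *)
have -> : N = cmod (B e (y * 1)).
  rewrite mulr1 /e Zl ec NN rmorphXn /=.
  by rewrite !cmodM cmodV cmodJ t1 cmod_real ?(ltW Np) // mul1r mulKf.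
apply: (@offdiagonal_le _ _ B (fun u x => B u (y * x)) zeta v w 1 e BP).
- split=> *; rewrite ?(mulrDr y) -?(scalerAr _ y) //.
- exact: Fv.
- move=> u; have := Fw u; rewrite mulrBl -scalerAl mul1r mulrBr linearB /=.
  by rewrite -scalerAr linearZ.
- by rewrite /B star1 mul1r mulr1.
- rewrite /e Zl Zr NN ec rmorphXn /=.
  by field: tt.
- rewrite /e Zr mulrAC.
  move: tr; case: (t * B 1 y) => r1 r2 /= ->.
  by rewrite expr0n /= addr0 !mul0r oppr0 mulr0 add0r.
Qed.

End StatesAt.

(** * Assembly of the chain of inequalities in the extended reals *)

Local Open Scope ereal_scope.

Theorem theorem3p12 (R : realType) (A : unitalCStarAlgType R) (a x y : A)
    (a_neq0 : a <> 0%R) (a_pos : cstar_positive a)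
    (x_adj : adjointable a x) (y_adj : adjointable a y) :
  let K1 := anorm a x * (aradius a y + adist a y) in
  let K2 := anorm a y * (aradius a x + adist a x) in
  let K3 := (aradius a x + adist a x) * (aradius a y + adist a y) in
  [/\ aradius a (x * y)%R <= anorm a (x * y)%R,
      anorm a (x * y)%R <= Order.min K1 (Order.min K2 K3)
    & Order.min K1 (Order.min K2 K3) <= 4%:E * aradius a x * aradius a y].
Proof.
move=> K1 K2 K3; split; first exact: aradius_le_anorm.
- have [[F FS]|S0] := pselect (states_at a !=set0)%classic; last first.
    by move/nonemptyPn: S0 => S0; rewrite /anorm S0 image_set0 ereal_sup0 leNye.
  have [nx ny] := (anorm_ge0 x FS, anorm_ge0 y FS).
  (* Each of [K1], [K2], [K3] replaces one or both factors of the product by a radius plus a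
     distance. *)
  apply: le_trans (anormM_le y a_pos x_adj) _.
  rewrite !le_min /K1 /K2 /K3 [anorm a y * _]muleC.
  by rewrite !lee_pmul ?anorm_le_aradiusD.
apply: le_trans (_ : _ <= K3) _; first by rewrite !ge_min lexx !orbT.
have [[F FS]|S0] := pselect (states_at a !=set0)%classic; last first.
  move/nonemptyPn: S0 => S0.
  (* Without states both radii are [-oo], and the product of two [-oo] is [+oo]. *)
  rewrite [leRHS](_ : _ = +oo) ?leey // /aradius S0.
  by rewrite !image_set0 ereal_sup0 (@gt0_muleNy _ 4%:E) ?lte_fin // mulNyNy.
(* The 4 is split as 2 times 2, because each distance is at most the radius. *)
have -> : 4%:E * aradius a x * aradius a y =
    (aradius a x + aradius a x) * (aradius a y + aradius a y).
  by rewrite -!mule2n -!mule_natl muleACA -EFinM -natrM muleA.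
by rewrite lee_pmul ?adde_ge0 ?leeD ?adist_le // ?(aradius_ge0 _ FS)
  ?(adist_ge0 _ FS).
Qed.
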